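(* Let $G$ and $H$ be two undirected graphs on a vertex set $V$ of cardinality $n$. Let $A_1$ and $B_1$ be the adjacency matrices of $G$ and $H$ respectively. Let $V_1, V_2, \ldots, V_p$ be a partition of $V$, and let $e_i \in \{0,1\}^V$ be the characteristic (column) vector of $V_i$. Define $J_{i,i} = e_i e_i^\top$ for $i = 1, 2, \ldots, p$, and let $k = 1 + p$. Let $\boldsymbol{A} = (A_1, J_{1,1}, J_{2,2}, \ldots, J_{p,p})$ and $\boldsymbol{B} = (B_1, J_{1,1}, J_{2,2}, \ldots, J_{p,p})$, which are $k$-tuples of $n \times n$ matrices. Then the matrices $W_{\boldsymbol{A}}(\boldsymbol{s})$ and $W_{\boldsymbol{B}}(\boldsymbol{s})$ have identically the same characteristic polynomials (that is, $\det(tI - W_{\boldsymbol{A}}(\boldsymbol{s})) = \det(tI - W_{\boldsymbol{B}}(\boldsymbol{s}))$ identically in $\boldsymbol{s}$ and $t$) if and only if there exists a fixed orthogonal matrix $Q$, independent of $\boldsymbol{s}$, such that $Q^\top A_1 Q = B_1$ and $Q^\top e_i = e_i$ for $i = 1, 2, \ldots, p$. Consequently, $Q^\top \widetilde{W}_{A_1} = \widetilde{W}_{B_1}$, where for an $n \times n$ matrix $A$ $$\widetilde{W}_{A} := [e_1, Ae_1, \ldots, A^{n-1} e_1, e_2, Ae_2, \ldots, A^{n-1} e_2, \ldots, e_p, A e_p, \ldots, A^{n-1} e_p].$$ In particular, if $\widetilde{W}_{A_1}$ is of full row rank, then $Q$ is unique and rational, and $\ell(Q) \mid d_n(\wideti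lde{W}_{A_1})$.
   Context: Graphs are simple: a graph is a pair $(V,E)$ with $E \subseteq \binom{V}{2}$ (no loops, no multiple edges, undirected edges). The adjacency matrix $A_G$ of $G=(V,E)$ is the $0$-$1$ matrix indexed by $V$ with $A_G(u,v) = 1$ if $uv \in E$ and $0$ otherwise. For a $k$-tuple $\boldsymbol{A} = (M_1, \ldots, M_k)$ of $n \times n$ matrices and a $k$-tuple $\boldsymbol{s} = (s_1, \ldots, s_k)$ of complex variables, $W_{\boldsymbol{A}}(\boldsymbol{s}) = \sum_{i=1}^k s_i M_i$, and its characteristic polynomial is $\phi_{\boldsymbol{A}}(\boldsymbol{s};t) = \det(tI - W_{\boldsymbol{A}}(\boldsymbol{s}))$. Orthogonal matrices are real orthogonal. A matrix is integral if all its entries are integers. For a rational matrix $M$, the level $\ell(M)$ is the smallest positive integer $\ell$ such that $\ell M$ is integral. For an $n \times m$ integral matrix $M$, a Smith decomposition is $M = U \Sigma V$ with $U$ ($n \times n$) and $V$ ($m \times m$) unimodular (integral with determinant $\pm 1$) and $\Sigma$ an $n \times m$ diagonal integral matrix whose diagonal entries satisfy $d_1 \mid d_2 \mid \cdots \mid d_{\min(n,m)}$; $d_{\min(n,m)}(M)$ is called the last invariant factor of $M$. Here $\widetilde{W}_{A_1}$ is an $n \times np$ integral matrix, so $d_n(\widetilde{W}_{A_1})$ is its last invariant factor. *)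

(* Defs.v *)
From HB Require Import structures.
From mathcomp Require Import all_boot all_order all_algebra.
From mathcomp Require Import reals complex.

Set Implicit Arguments.
Unset Strict Implicit.
Unset Printing Implicit Defensive.

Import Order.TTheory GRing.Theory Num.Theory.
Local Open Scope ring_scope.

Record sgraph (V : finType) := SGraph {
  edges : {set {set V}};
  edges_card2 : {in edges, forall E : {set V}, #|E| = 2%N} }.

(* The coefficient ring is a parameter because the same 0-1 matrix is used
   over the complex numbers, over the reals and over the integers. *)
Definition adjmx (T : pzRingType) n (G : sgraph 'I_n) : 'M[T]_n :=
  \matrix_(u, v) ([set u; v] \in edges G)%:R.

(* Nonempty classes indexed without repetition by 'I_p. *)
Definition vertex_partition (V : finType) p (P : 'I_p -> {set V}) : Prop :=
  injective P /\ partition [set P i | i : 'I_p] [set: V].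

Definition charvec (T : pzRingType) n (S : {set 'I_n}) : 'cV[T]_n :=
  \col_v (v \in S)%:R.

Definition Jmx (T : pzRingType) n (S : {set 'I_n}) : 'M[T]_n :=
  charvec T S *m (charvec T S)^T.

Definition adj_J_tuple (T : pzRingType) n p (P : 'I_p -> {set 'I_n})
    (G : sgraph 'I_n) : (1 + p).-tuple 'M[T]_n :=
  [tuple of adjmx T G :: [tuple Jmx T (P i) | i < p]].

Definition lincomb_mx (T : comPzRingType) n k (M : k.-tuple 'M[T]_n)
    (s : k.-tuple T) : 'M[T]_n :=
  \sum_(i < k) tnth s i *: tnth M i.

Definition multi_charpoly (T : comPzRingType) n k (M : k.-tuple 'M[T]_n)
    (s : k.-tuple T) (t : T) : T :=
  \det (t%:M - lincomb_mx M s).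

Definition orthogonal_mx (T : pzRingType) n (Q : 'M[T]_n) : Prop :=
  Q^T *m Q = 1%:M /\ Q *m Q^T = 1%:M.

(* The i-th block of n columns is [e_i, A e_i, ..., A^(n-1) e_i]. *)
Definition walk_mx (T : pzRingType) n p (P : 'I_p -> {set 'I_n})
    (A : 'M[T]_n) : 'M[T]_(n, \sum_(i < p) n) :=
  \mxrow_(i < p) \matrix_(v < n, j < n) (A ^+ j *m charvec T (P i)) v 0.

Definition integral_mx m n (M : 'M[rat]_(m, n)) : bool :=
  M \is a mxOver Num.int.

Lemma level_exists m n (M : 'M[rat]_(m, n)) :
  exists l : nat, (0 < l)%N && integral_mx (l%:R *: M).
Proof.
pose f (ij : 'I_m * 'I_n) : nat := `|denq (M ij.1 ij.2)|%N.
exists (\prod_ij f ij)%N; apply/andP; split.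
  by apply: prodn_gt0 => ij; rewrite absz_gt0 denq_neq0.
apply/mxOverP => i j; rewrite mxE (bigD1 (i, j)) //= mulnC natrM -mulrA.
apply: rpredM; first exact: rpred_nat.
have -> : (f (i, j))%:R = (denq (M i j))%:~R :> rat.
  by rewrite /f /= pmulrn gez0_abs ?denq_ge0.
by rewrite mulrC -numqE; apply: rpred_int.
Qed.

Definition level m n (M : 'M[rat]_(m, n)) : nat := ex_minn (level_exists M).

Definition unimodular n (U : 'M[int]_n) : Prop := \det U = 1 \/ \det U = -1.

(* M = U Sigma V, where d lists the min(m, n) diagonal entries of Sigma; no
   sign is imposed on them. *)
Definition Smith_decomposition m n (M : 'M[int]_(m, n))
    (U : 'M[int]_m) (d : seq int) (V : 'M[int]_n) : Prop :=
  [/\ unimodular U, unimodular V, size d = minn m n, sorted dvdz d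
    & M = U *m (\matrix_(i < m, j < n) (d`_i *+ (i == j :> nat))) *m V].

(* The last invariant factor is determined only up to sign, hence a relation.
   For an empty matrix the value is the default 0. *)
Definition last_invariant_factor m n (M : 'M[int]_(m, n)) (x : int) : Prop :=
  exists U d V, Smith_decomposition M U d V /\ x = d`_(minn m n).-1.

Lemma last_invariant_factor_exists m n (M : 'M[int]_(m, n)) :
  exists x, last_invariant_factor M x.
Proof.
have unimodularP k (U : 'M[int]_k) : U \in unitmx -> unimodular U.
  by rewrite unitmxE => /orP[] /eqP; [left | right].
have [U /unimodularP uU [V /unimodularP uV [d d_sorted ->]]] :=
  int_Smith_normal_form M.
pose d' := mkseq (fun i => d`_i) (minn m n).
exists d'`_(minn m n).-1, U, d', V; split=> //; split=> //.
- by rewrite size_mkseq.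
- apply/(sortedP 0) => i; rewrite size_mkseq => lti.
  rewrite !nth_mkseq ?(ltnW lti) //.
  have [ltid|] := ltnP i.+1 (size d); first exact/(sortedP 0).
  by move=> /(nth_default 0) ->; exact: dvdz0.
- congr (_ *m _ *m _); apply/matrixP => i j; rewrite !mxE.
  case: eqP => [eij|]; last by rewrite !mulr0n.
  by rewrite nth_mkseq // leq_min ltn_ord eij ltn_ord.
Qed.

(* Main.v *)
Require Import Defs.
From HB Require Import structures.
From mathcomp Require Import all_boot all_order all_algebra.
From mathcomp Require Import reals complex.

Set Implicit Arguments.
Unset Strict Implicit.
Unset Printing Implicit Defensive.

Import Order.TTheory GRing.Theory Num.Theory.
Local Open Scope ring_scope.

(** Write [u_i] for the characteristic vector of the i-th class and [A], [B]
    for the two adjacency matrices.  An orthogonal [Q] carrying [A] to [B] and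
    fixing every [u_i] conjugates one pencil into the other, so only the
    construction of [Q] from the equality of characteristic polynomials needs
    an idea.  It goes through the walk counts [u_i^T A^k u_j].

    Specialize the identity at [t = 1] to real weights [z] on the adjacency
    matrix and 0, 1 or 2 on the [J_i].  With [M = 1 - z A], the rank-one and
    rank-two determinant formulas turn it into the equality, for [A] and [B],
    of the diagonal resolvent entries [u_i^T M^-1 u_i] and of the squares of
    the off-diagonal ones [u_i^T M^-1 u_j] ([resolvent_sqr]).  After
    multiplication by [det M] an entry is a polynomial in [z], so for each pair
    of classes the two entries agree up to a sign that does not depend on [z];
    expanding in powers of [z], all the walk counts between these classes agree
    up to that same sign ([resolvent_moments]).  Walk counts are nonnegative, so
    the sign is harmless ([eq_charpoly_walk_counts]).

    Weight 1 on the adjacency matrix and 0 on all the [J_i], with [t] arbitrary,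
    shows that [A] and [B] are cospectral, hence orthogonally similar to the
    same diagonal matrix [D] ([cospectral_diagonalization]).  In these coordinates the [u_i] become two
    families [x_i] and [y_i] with [x_i^T D^k x_j = y_i^T D^k y_j] for all [k].
    By interpolation the same holds with [D^k] replaced by the projection onto
    any eigenspace of [D], and a product of reflections along eigenvectors,
    which commute with [D], carries every [x_i] to [y_i]
    ([equal_moments_isometry]).

    For the arithmetic part, a Smith decomposition [W = U S V] of the integral
    walk matrix turns [Q^T W = W'] into the integrality of [(Q^T U) S].  Every
    diagonal entry of [S] divides the last one, [d], so [d Q^T U] and then
    [d Q^T] are integral.  Full row rank forces [d] to be nonzero, hence [Q] to
    be rational, and the level divides every integer clearing the denominators
    of [Q]. *)

(** * Determinants of low-rank perturbations *)

(** Both sides are the determinant of the block matrix [[1, X; Y, 1]], by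
    elimination along its two diagonal blocks. *)
Lemma det_1_sub_mulmxC (R : comNzRingType) m n (X : 'M[R]_(m, n))
    (Y : 'M[R]_(n, m)) :
  \det (1%:M - X *m Y) = \det (1%:M - Y *m X).
Proof.
have e1 : block_mx 1%:M X Y 1%:M
    = block_mx 1%:M 0 Y 1%:M *m block_mx 1%:M X 0 (1%:M - Y *m X).
  by rewrite mulmx_block !mul1mx !mulmx1 !mul0mx !addr0 addrC subrK.
have e2 : block_mx 1%:M X Y 1%:M
    = block_mx 1%:M X 0 1%:M *m block_mx (1%:M - X *m Y) 0 Y 1%:M.
  by rewrite mulmx_block !mul1mx !mulmx1 !mul0mx !add0r subrK.
have := congr1 determinant e1; rewrite e2 !det_mulmx.
by rewrite !det_ublock !det_lblock !det1 !mulr1 !mul1r.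
Qed.

Lemma det_mx2 (R : comNzRingType) (M : 'M[R]_2) :
    \det M = M 0 0 * M 1 1 - M 0 1 * M 1 0.
Proof.
rewrite (expand_det_row _ 0) !big_ord_recl big_ord0 addr0 /cofactor !det_mx11.
rewrite !mxE /= !expr0 !expr1 !mul1r mulN1r mulrN.
have e01 : lift 0 0 = 1 :> 'I_2 by apply/val_inj.
have e10 : lift 1 0 = 0 :> 'I_2 by apply/val_inj.
by rewrite ?e01 ?e10 ?mulNr ?mulrN.
Qed.

Definition bil (R : pzRingType) n (u : 'cV[R]_n) (M : 'M[R]_n) (v : 'cV[R]_n) :=
  (u^T *m M *m v) 0 0.

Lemma det_sub_outer (R : fieldType) n m (M : 'M[R]_n) (K : 'M[R]_(n, m)) :
  M \in unitmx ->
  \det (M - K *m K^T) = \det M * \det (1%:M - K^T *m invmx M *m K).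
Proof.
move=> uM; rewrite -[K^T *m _ *m K]mulmxA -det_1_sub_mulmxC.
by rewrite -det_mulmx mulmxBr mulmx1 !mulmxA mulmxV // mul1mx.
Qed.

Lemma det_sub_outer1 (R : fieldType) n (M : 'M[R]_n) (u : 'cV[R]_n) :
  M \in unitmx ->
  \det (M - u *m u^T) = \det M * (1 - bil u (invmx M) u).
Proof.
move=> uM; rewrite det_sub_outer // det_mx11 /bil mxE [1%:M _ _]mxE.
by rewrite [X in _ * (_ + X)]mxE.
Qed.

(** The scalar factor is the 2 x 2 determinant of [1 - K^T M^-1 K], where the
    columns of [K] are [u] and [v]. *)
Lemma det_sub_outer2 (R : fieldType) n (M : 'M[R]_n) (u v : 'cV[R]_n) :
  M \in unitmx ->
  \det (M - (u *m u^T + v *m v^T)) = \det M *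
    ((1 - bil u (invmx M) u) * (1 - bil v (invmx M) v)
     - bil u (invmx M) v * bil v (invmx M) u).
Proof.
move=> uM.
have -> : u *m u^T + v *m v^T = row_mx u v *m (row_mx u v)^T.
  by rewrite tr_row_mx mul_row_col.
rewrite det_sub_outer //; set K := row_mx u v; set N := K^T *m _ *m K.
have entry (a b : 'I_(1 + 1)) :
    (1%:M - N) a b = (a == b)%:R - bil (col a K) (invmx M) (col b K).
  rewrite [LHS]mxE [1%:M _ _]mxE [X in _ + X]mxE; congr (_ - _).
  by rewrite /bil tr_col -!row_mul [RHS]mxE colE mulmxA -colE [RHS]mxE.
rewrite det_mx2 !entry.
have -> : 1 = rshift 1 0 :> 'I_(1 + 1) by apply/val_inj.
have -> : 0 = lshift 1 0 :> 'I_(1 + 1) by apply/val_inj.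
by rewrite !colKl !colKr !col_id /= !sub0r mulrNN.
Qed.

Lemma bilC (R : comPzRingType) n (M : 'M[R]_n) (u v : 'cV[R]_n) :
  M^T = M -> bil v M u = bil u M v.
Proof.
move=> sM; rewrite /bil -[in RHS](trmxK (u^T *m M *m v)) [RHS]mxE.
by rewrite !trmx_mul trmxK sM mulmxA.
Qed.

(** * Moments from the squares of resolvent entries *)

Lemma bilB (R : pzRingType) n (u v : 'cV[R]_n) (M N : 'M[R]_n) :
  bil u (M - N) v = bil u M v - bil u N v.
Proof. by rewrite /bil mulmxBr mulmxBl !mxE. Qed.

Lemma bilZ (R : comPzRingType) n (u v : 'cV[R]_n) a (M : 'M[R]_n) :
  bil u (a *: M) v = a * bil u M v.
Proof. by rewrite /bil -scalemxAr -scalemxAl mxE. Qed.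

Lemma tr_invmx_sym (R : fieldType) n (M : 'M[R]_n) :
  M^T = M -> (invmx M)^T = invmx M.
Proof. by move=> sM; rewrite trmx_inv sM. Qed.

(** Rank-one perturbations reveal the diagonal entries of the resolvent; the
    rank-two one reveals the product of the two off-diagonal entries, which are
    equal by symmetry.  Hence only the square of an off-diagonal entry is
    determined. *)
Lemma resolvent_sqr (R : fieldType) n (M N : 'M[R]_n) (u v : 'cV[R]_n) :
  M^T = M -> N^T = N -> \det M = \det N -> \det M != 0 ->
  \det (M - u *m u^T) = \det (N - u *m u^T) ->
  \det (M - v *m v^T) = \det (N - v *m v^T) ->
  \det (M - (u *m u^T + v *m v^T)) = \det (N - (u *m u^T + v *m v^T)) ->
  bil u (\adj M) v ^+ 2 = bil u (\adj N) v ^+ 2.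
Proof.
move=> sM sN eD nzD.
have uM : M \in unitmx by rewrite unitmxE unitfE.
have uN : N \in unitmx by rewrite unitmxE -eD unitfE.
have adjE (L : 'M[R]_n) : L \in unitmx ->
    bil u (\adj L) v = \det L * bil u (invmx L) v.
  move=> uL; rewrite /bil /invmx uL -scalemxAr -scalemxAl [in RHS]mxE mulrA.
  by rewrite mulfV ?mul1r // -unitfE -unitmxE.
rewrite !det_sub_outer1 // !det_sub_outer2 // -eD !adjE // !exprMn -eD.
move=> /(mulfI nzD)/addrI/oppr_inj eu /(mulfI nzD)/addrI/oppr_inj ev.
move=> /(mulfI nzD); rewrite eu ev => /addrI/oppr_inj.
by rewrite !(@bilC _ _ _ u v) ?tr_invmx_sym // -!expr2 => ->.
Qed.

Lemma poly_ext (R : numDomainType) (p q : {poly R}) :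
  (forall x, p.[x] = q.[x]) -> p = q.
Proof.
move=> epq; apply/eqP; rewrite -subr_eq0; apply/eqP.
apply: (@roots_geq_poly_eq0 _ _ [seq i%:R | i <- iota 0 (size (p - q))]).
- by apply/allP => x _; rewrite rootE !hornerE epq subrr.
- by rewrite map_inj_uniq ?iota_uniq // => i j /eqP; rewrite eqr_nat => /eqP.
- by rewrite size_map size_iota.
Qed.

Lemma poly_sqr_ext (R : numDomainType) (d p q : {poly R}) :
  d != 0 -> (forall z, d.[z] != 0 -> p.[z] ^+ 2 = q.[z] ^+ 2) ->
  p ^+ 2 = q ^+ 2.
Proof.
move=> nzd epq; apply: (mulfI nzd); apply: poly_ext => z.
rewrite !expr2 !hornerM.
by have [->|/epq] := eqVneq d.[z] 0; rewrite ?mul0r // -!expr2 => ->.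
Qed.

(** The first terms differ by a sign [s].  Evaluating the recurrence at 0
    extracts the scalar coefficient, and dividing by ['X] gives the next
    polynomial, so the same [s] propagates to every index. *)
Lemma signed_recurrence (R : idomainType) (d : {poly R})
    (N N' : nat -> {poly R}) (a b : nat -> R) :
  d.[0] = 1 ->
  (forall k, N k - 'X * N k.+1 = (a k)%:P * d) ->
  (forall k, N' k - 'X * N' k.+1 = (b k)%:P * d) ->
  N 0%N ^+ 2 = N' 0%N ^+ 2 ->
  exists2 s : R, s ^+ 2 = 1 & forall k, a k = s * b k.
Proof.
move=> d0 recN recN' eN2.
have head (M : nat -> {poly R}) c :
    (forall k, M k - 'X * M k.+1 = (c k)%:P * d) -> forall k, (M k).[0] = c k.
  move=> /(_ _)/(congr1 (horner^~ 0)) recM k; have := recM k.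
  by rewrite hornerD hornerN !hornerM hornerX mul0r subr0 d0 mulr1 hornerC.
have [s s2 eNs] : exists2 s : R, s ^+ 2 = 1 & N 0%N = s%:P * N' 0%N.
  move/eqP: eN2; rewrite eqf_sqr => /orP[] /eqP ->.
    by exists 1; rewrite ?expr1n ?mul1r.
  by exists (-1); rewrite ?sqrrN ?expr1n // polyCN mulN1r.
exists s => // k; rewrite -(head _ _ recN) -(head _ _ recN').
suff -> : N k = s%:P * N' k by rewrite hornerM hornerC.
elim: k => // k IHk.
have e : a k = s * b k.
  by rewrite -(head _ _ recN) -(head _ _ recN') IHk hornerM hornerC.
apply: (@mulfI _ 'X); first by rewrite polyX_eq0.
apply/oppr_inj/(addrI (N k)).
by rewrite recN e {1}IHk mulrCA -mulrBr recN' polyCM mulrA.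
Qed.

(** The polynomials [N k = u^T A^k adj(1 - 'X A) v] satisfy
    [N k - 'X N (k + 1) = (u^T A^k v) det(1 - 'X A)], because [adj M] is
    inverse to [M] up to the determinant.  Using the pencil [1 - 'X A] instead
    of ['X - A] gives a determinant of constant term 1 and spares any degree
    count. *)
Lemma resolvent_moments (R : numFieldType) n (A B : 'M[R]_n) (u v : 'cV[R]_n) :
  (forall z, \det (1%:M - z *: A) = \det (1%:M - z *: B)) ->
  (forall z, \det (1%:M - z *: A) != 0 ->
     bil u (\adj (1%:M - z *: A)) v ^+ 2
     = bil u (\adj (1%:M - z *: B)) v ^+ 2) ->
  exists2 s : R, s ^+ 2 = 1 &
    forall k, bil u (A ^+ k) v = s * bil u (B ^+ k) v.
Proof.
pose pu := map_mx polyC u; pose pv := map_mx polyC v.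
pose pencil (L : 'M[R]_n) : 'M[{poly R}]_n := 1%:M - 'X *: map_mx polyC L.
pose N L k := bil pu (map_mx polyC (L ^+ k) *m \adj (pencil L)) pv.
have eval_pencil (L : 'M_n) z :
    map_mx (horner_eval z) (pencil L) = 1%:M - z *: L.
  apply/matrixP => i j; rewrite !mxE /horner_eval !hornerE.
  by case: (i == j); rewrite !hornerE.
have horner_bil (M : 'M[{poly R}]_n) z :
    (bil pu M pv).[z] = bil u (map_mx (horner_eval z) M) v.
  have evalC m (w : 'M[R]_(n, m)) : map_mx (horner_eval z) (map_mx polyC w) = w.
    by apply/matrixP => i j; rewrite !mxE /horner_eval hornerC.
  rewrite -[LHS]/(horner_eval z _) /bil.
  rewrite -[in RHS](evalC _ u) -[in RHS](evalC _ v).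
  have -> : map_mx (horner_eval z) (map_mx polyC u)
    = (map_mx (horner_eval z) pu^T)^T by rewrite -map_trmx trmxK.
  by rewrite -[map_mx polyC v]/pv trmxK -!map_mxM [RHS]mxE.
have N_rec L k :
    N L k - 'X * N L k.+1 = (bil u (L ^+ k) v)%:P * \det (pencil L).
  rewrite /N -bilZ -bilB exprSr map_mxM -mulmxA scalemxAr -mulmxBr scalemxAl.
  rewrite -[X in X - _]mul1mx -mulmxBl mul_mx_adj mul_mx_scalar bilZ.
  rewrite mulrC; congr (_ * _).
  by rewrite /bil map_trmx -!map_mxM mxE.
have detE L z : (\det (pencil L)).[z] = \det (1%:M - z *: L).
  by rewrite -[LHS]/(horner_eval z _) -det_map_mx eval_pencil.
move=> eD eN.
have epD : \det (pencil A) = \det (pencil B).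
  by apply: poly_ext => z; rewrite !detE.
have D0 L : (\det (pencil L)).[0] = 1 by rewrite detE scale0r subr0 det1.
have evalN0 L z : (N L 0%N).[z] = bil u (\adj (1%:M - z *: L)) v.
  by rewrite /N horner_bil expr0 map_mx1 mul1mx map_mx_adj eval_pencil.
apply: (@signed_recurrence _ (\det (pencil A)) (N A) (N B)).
- exact: D0.
- exact: N_rec.
- by move=> k; rewrite epD N_rec.
- apply: (@poly_sqr_ext _ (\det (pencil A))) => [|z].
    by apply/eqP => e; have /eqP := D0 A; rewrite e hornerE eq_sym oner_eq0.
  rewrite detE => nz.
  have sqrE L : (N L 0%N).[z] ^+ 2 = bil u (\adj (1%:M - z *: L)) v ^+ 2.
    by congr (_ ^+ 2); exact: evalN0.
  exact: etrans (sqrE A) (etrans (eN z nz) (esym (sqrE B))).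
Qed.

(** * Orthogonal matrices and reflections *)

Definition dot (R : pzRingType) n (u v : 'cV[R]_n) : R := (u^T *m v) 0 0.

Lemma mul_tr_col (R : pzRingType) n (u v : 'cV[R]_n) : u^T *m v = (dot u v)%:M.
Proof. exact: mx11_scalar. Qed.

Lemma dotC (R : comPzRingType) n (u v : 'cV[R]_n) : dot u v = dot v u.
Proof. by rewrite /dot !mxE; apply: eq_bigr => i _; rewrite !mxE mulrC. Qed.

Lemma dotBl (R : pzRingType) n (u v w : 'cV[R]_n) :
  dot (u - v) w = dot u w - dot v w.
Proof. by rewrite /dot linearB mulmxBl !mxE. Qed.

Lemma dotBr (R : pzRingType) n (u v w : 'cV[R]_n) :
  dot w (u - v) = dot w u - dot w v.
Proof. by rewrite /dot mulmxBr !mxE. Qed.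

Lemma dot_eq0 (R : realDomainType) n (w : 'cV[R]_n) : (dot w w == 0) = (w == 0).
Proof.
apply/idP/eqP => [|->]; last by rewrite /dot mulmx0 mxE.
rewrite /dot mxE psumr_eq0 => [/allP w0|i _]; last first.
  by rewrite mxE -expr2 sqr_ge0.
apply/matrixP => i j; rewrite ord1 mxE; apply/eqP.
by have := w0 i (mem_index_enum _); rewrite mxE mulf_eq0 orbb.
Qed.

Lemma dot_orthogonal (R : comPzRingType) n (Q : 'M[R]_n) (u v : 'cV[R]_n) :
  Q^T *m Q = 1%:M -> dot (Q *m u) (Q *m v) = dot u v.
Proof.
by move=> oQ; rewrite /dot trmx_mul mulmxA -(mulmxA _ Q^T) oQ mulmx1.
Qed.

(** If [dot w w = 0], the convention [0^-1 = 0] makes this the identity, so that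
    it is an orthogonal matrix for every [w]. *)
Definition reflection (R : fieldType) n (w : 'cV[R]_n) : 'M[R]_n :=
  1%:M - (2 / dot w w) *: (w *m w^T).

Lemma tr_reflection (R : fieldType) n (w : 'cV[R]_n) :
  (reflection w)^T = reflection w.
Proof. by rewrite /reflection linearB linearZ /= trmx1 trmx_mul trmxK. Qed.

Lemma reflectionE (R : fieldType) n (w x : 'cV[R]_n) :
  reflection w *m x = x - (2 / dot w w * dot w x) *: w.
Proof.
rewrite mulmxBl mul1mx -scalemxAl -mulmxA mul_tr_col mul_mx_scalar.
by rewrite scalerA.
Qed.

Lemma reflectionK (R : fieldType) n (w : 'cV[R]_n) :
  reflection w *m reflection w = 1%:M.
Proof.
rewrite /reflection; set c := 2 / dot w w; set W := w *m w^T.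
have cW : (c * c) *: (W *m W) = c *: W + c *: W.
  have -> : W *m W = dot w w *: W.
    by rewrite mulmxA -(mulmxA w) mul_tr_col mul_mx_scalar -scalemxAl.
  rewrite scalerA -scalerDl -mulrA; congr (_ *: _).
  have [q0|q_neq0] := eqVneq (dot w w) 0; last by rewrite divfK // mulr_natr.
  by rewrite /c q0 invr0 mulr0 mul0r addr0.
rewrite mulmxBl mul1mx mulmxBr mulmx1 -scalemxAl -scalemxAr scalerA cW.
by rewrite opprB addrK subrK.
Qed.

Lemma reflection_swap (R : realFieldType) n (u v : 'cV[R]_n) :
  dot u u = dot v v -> reflection (u - v) *m u = v.
Proof.
move=> euv; rewrite reflectionE.
have [/eqP|nz] := eqVneq (dot (u - v) (u - v)) 0.
  by rewrite dot_eq0 subr_eq0 => /eqP ->; rewrite subrr scaler0 subr0.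
have -> : dot (u - v) u = dot (u - v) (u - v) / 2.
  apply: (mulIf (_ : 2 != 0)); rewrite ?pnatr_eq0 // divfK ?pnatr_eq0 //.
  rewrite !dotBl !dotBr (dotC u v) -euv mulr_natr mulr2n.
  by rewrite opprB addrA.
by rewrite mulrA divfK // divff ?pnatr_eq0 // scale1r opprB addrC subrK.
Qed.

Lemma reflection_fix (R : fieldType) n (w x : 'cV[R]_n) :
  dot w x = 0 -> reflection w *m x = x.
Proof. by move=> wx0; rewrite reflectionE wx0 mulr0 scale0r subr0. Qed.

Lemma reflection_comm (R : fieldType) n (A : 'M[R]_n) (w : 'cV[R]_n) a :
  A^T = A -> A *m w = a *: w -> reflection w *m A = A *m reflection w.
Proof.
move=> sA Aw; rewrite mulmxBl mulmxBr mul1mx mulmx1 -scalemxAl -scalemxAr.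
have -> : w *m w^T *m A = a *: (w *m w^T).
  by rewrite -mulmxA -{1}sA -trmx_mul Aw linearZ /= -scalemxAr.
by rewrite mulmxA Aw -scalemxAl.
Qed.

Lemma orthogonal_mul (R : comPzRingType) n (P Q : 'M[R]_n) :
  orthogonal_mx P -> orthogonal_mx Q -> orthogonal_mx (P *m Q).
Proof.
move=> [P1 P2] [Q1 Q2]; split; rewrite trmx_mul !mulmxA.
  by rewrite -(mulmxA _ P^T) P1 mulmx1.
by rewrite -(mulmxA P) Q2 mulmx1.
Qed.

Lemma orthogonal_tr (R : comPzRingType) n (Q : 'M[R]_n) :
  orthogonal_mx Q -> orthogonal_mx Q^T.
Proof. by move=> [Q1 Q2]; split; rewrite trmxK. Qed.

Lemma orthogonal1 (R : comPzRingType) n : orthogonal_mx (1%:M : 'M[R]_n).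
Proof. by split; rewrite trmx1 mulmx1. Qed.

Lemma reflection_orthogonal (R : fieldType) n (w : 'cV[R]_n) :
  orthogonal_mx (reflection w).
Proof. by split; rewrite tr_reflection reflectionK. Qed.

(** Carry the vectors one pair at a time.  If [Q] already matches the earlier
    pairs, reflect along [Q u - v]: this sends [Q u] to [v]; it fixes the
    earlier images because the Gram matrices agree; it commutes with [A] because
    [Q u - v] is again an eigenvector. *)
Lemma eigenpairs_isometry (R : realFieldType) n (A : 'M[R]_n)
    (s : seq (R * ('cV[R]_n * 'cV[R]_n))) :
  A^T = A ->
  {in s, forall x, A *m x.2.1 = x.1 *: x.2.1 /\ A *m x.2.2 = x.1 *: x.2.2} ->
  {in s &, forall x y, dot x.2.1 y.2.1 = dot x.2.2 y.2.2} ->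
  exists Q, [/\ orthogonal_mx Q, Q *m A = A *m Q
    & {in s, forall x, Q *m x.2.1 = x.2.2}].
Proof.
move=> sA; elim: s => [|[a [u v]] s IHs] eigen gram.
  by exists 1%:M; split=> //; [exact: orthogonal1 | rewrite mul1mx mulmx1].
have [x sx|x y sx sy|Q [oQ QA Qs]] := IHs.
- by apply: eigen; rewrite inE sx orbT.
- by apply: gram; rewrite inE ?sx ?sy orbT.
have [Au Av] := eigen _ (mem_head _ _).
pose w := Q *m u - v.
exists (reflection w *m Q); split.
- by apply: orthogonal_mul => //; exact: reflection_orthogonal.
- rewrite -mulmxA QA !mulmxA (@reflection_comm _ _ _ _ a) //.
  by rewrite mulmxBr mulmxA -QA -mulmxA Au Av -scalemxAr -scalerBr.
move=> x; rewrite inE => /predU1P[->|sx] /=.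
  rewrite -mulmxA reflection_swap // dot_orthogonal ?(proj1 oQ) //.
  exact: (gram _ _ (mem_head _ _) (mem_head _ _)).
rewrite -mulmxA Qs // reflection_fix // dotBl -[in dot (Q *m u) _](Qs x sx).
rewrite dot_orthogonal ?(proj1 oQ) //.
by rewrite (gram (a, (u, v)) x) ?mem_head ?subrr // inE sx orbT.
Qed.

(** * Simultaneous diagonalization of cospectral symmetric matrices *)

Lemma dotZZ (R : comPzRingType) n a b (u v : 'cV[R]_n) :
  dot (a *: u) (b *: v) = a * b * dot u v.
Proof.
by rewrite /dot [(a *: u)^T]linearZ /= -scalemxAl -scalemxAr scalerA mxE.
Qed.

(** Over the complex numbers a real symmetric matrix is Hermitian, and the
    diagonal of its spectral decomposition is real. *)
Lemma symmetric_real_root (R : rcfType) n (A : 'M[R]_n.+1) :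
  A^T = A -> exists a, root (char_poly A) a.
Proof.
move=> sA; pose C : numClosedFieldType := R[i].
pose Ac : 'M[C]_n.+1 := map_mx (real_complex R) A.
have hA : Ac \is hermsymmx.
  apply: realsym_hermsym.
    apply/is_hermitianmxP.
    by rewrite expr0 scale1r map_mx_id // /Ac map_trmx sA.
  by apply/mxOverP => i j; rewrite mxE complex_real.
have /hermitian_spectral_diag_real/mxOverP/(_ 0 0)/complex_realP[a da] := hA.
exists a; rewrite -(fmorph_root (real_complex R)) map_char_poly.
rewrite -eigenvalue_root_char.
have /hermitian_normalmx/orthomx_spectralP eA := hA.
have uP := spectral_unit Ac.
apply/eigenvalueP; exists (row 0 (spectralmx Ac)).
  rewrite -/Ac -row_mul {2}eA !mulmxA mulmxV // mul1mx row_mul.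
  rewrite row_diag_mx -scalemxAl -rowE.
  by rewrite [X in X *: _]da.
by apply/eqP => r0; move: uP; rewrite -row_free_unit => /row_freeP[L PL];
  have /eqP := congr1 (row 0) PL; rewrite row_mul r0 mul0mx rowE mulmx1
  => /eqP/matrixP/(_ 0 0)/eqP; rewrite !mxE !eqxx eq_sym oner_eq0.
Qed.

Lemma char_poly_orthogonal (R : comNzRingType) n (Q A : 'M[R]_n) :
  orthogonal_mx Q -> char_poly (Q *m A *m Q^T) = char_poly A.
Proof.
move=> [_ QQ]; pose q := map_mx (@polyC R) Q.
have qq : q *m q^T = 1%:M by rewrite map_trmx -map_mxM QQ map_mx1.
rewrite /char_poly; transitivity (\det (q *m char_poly_mx A *m q^T)).
  congr (\det _); rewrite /char_poly_mx mulmxBr mulmxBl !map_mxM -map_trmx.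
  by rewrite -[map_mx _ Q]/q [q *m _%:M]scalar_mxC -(mulmxA _ q) qq mulmx1.
by rewrite !det_mulmx mulrAC -det_mulmx qq det1 mul1r.
Qed.

Lemma char_poly_block1 (R : comNzRingType) n a (A : 'M[R]_n) :
  char_poly (block_mx a%:M 0 0 A : 'M_(1 + n)) = ('X - a%:P) * char_poly A.
Proof.
rewrite /char_poly /char_poly_mx map_block_mx !map_mx0 scalar_mx_block.
rewrite opp_block_mx add_block_mx !oppr0 !addr0 det_ublock; congr (_ * _).
by rewrite det_mx11 !mxE !eqxx !mulr1n.
Qed.

Lemma symmetric_block1 (R : comPzRingType) n (M : 'M[R]_(1 + n)) a :
  M^T = M -> M *m delta_mx 0 0 = a *: delta_mx 0 0 :> 'cV_(1 + n) ->
  M = block_mx a%:M 0 0 (drsubmx M).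
Proof.
move=> sM; rewrite -colE => /matrixP eM.
have ent i : M i 0 = a * (i == 0)%:R.
  by have := eM i 0; rewrite !mxE !eqxx andbT.
have e0 : lshift n 0 = 0 :> 'I_(1 + n) by apply/val_inj.
have dl0 : dlsubmx M = 0.
  apply/matrixP => i j; rewrite !mxE (ord1 j) e0 ent.
  by rewrite -(inj_eq val_inj) mulr0.
rewrite -[LHS]submxK dl0; congr block_mx; last first.
  by rewrite -[LHS]trmxK trmx_ursub sM dl0 trmx0.
by apply/matrixP => i j; rewrite !mxE !ord1 !e0 ent eqxx mulr1 mulr1n.
Qed.

(** Reflect a unit eigenvector onto the first basis vector; symmetry then
    clears the first row along with the first column. *)
Lemma symmetric_deflation (R : rcfType) n (A : 'M[R]_(1 + n)) a :
  A^T = A -> root (char_poly A) a ->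
  exists Q (A' : 'M[R]_n), [/\ orthogonal_mx Q, A'^T = A'
    & Q *m A *m Q^T = block_mx a%:M 0 0 A'].
Proof.
move=> sA; rewrite -eigenvalue_root_char => /eigenvalueP[r rA r_neq0].
pose w := (Num.sqrt (dot r^T r^T))^-1 *: r^T.
have Aw : A *m w = a *: w.
  by rewrite -scalemxAr -{1}sA -trmx_mul rA linearZ /= !scalerA mulrC.
pose e : 'cV[R]_(1 + n) := delta_mx 0 0.
have ww : dot w w = dot e e.
  rewrite dotZZ [RHS]/dot trmx_delta mul_delta_mx !mxE !eqxx mulr1n.
  rewrite -expr2 exprVn sqr_sqrtr.
    by rewrite mulVf // dot_eq0 -(inj_eq trmx_inj) trmxK trmx0.
  by rewrite /dot mxE; apply: sumr_ge0 => i _; rewrite mxE -expr2 sqr_ge0.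
pose H := reflection (w - e).
have Hw : H *m w = e by exact: reflection_swap.
have He : H *m e = w by rewrite -Hw mulmxA reflectionK mul1mx.
pose M := H *m A *m H^T.
have sM : M^T = M by rewrite /M !trmx_mul trmxK sA mulmxA.
have Me : M *m e = a *: e.
  by rewrite /M tr_reflection -!mulmxA He Aw -scalemxAr Hw.
exists H, (drsubmx M); split; first exact: reflection_orthogonal.
  by rewrite trmx_drsub sM.
exact: symmetric_block1.
Qed.

Lemma orthogonal_block1 (R : comPzRingType) n (Q : 'M[R]_n) :
  orthogonal_mx Q -> orthogonal_mx (block_mx 1%:M 0 0 Q : 'M_(1 + n)).
Proof.
move=> [Q1 Q2]; split; rewrite tr_block_mx !trmx0 trmx1 mulmx_block;
by rewrite !mulmx0 !mul0mx mulmx1 ?Q1 ?Q2 !addr0 add0r -scalar_mx_block.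
Qed.

(** Deflating both matrices along a common eigenvalue leaves smaller
    cospectral matrices, so induction produces the same diagonal on both sides
    without sorting eigenvalues. *)
Lemma cospectral_diagonalization (R : rcfType) n (A B : 'M[R]_n) :
  A^T = A -> B^T = B -> char_poly A = char_poly B ->
  exists U V d, [/\ orthogonal_mx U, orthogonal_mx V,
    U *m A *m U^T = diag_mx d & V *m B *m V^T = diag_mx d].
Proof.
elim: n A B => [|n IHn] A B sA sB eAB.
  exists 1%:M, 1%:M, 0; split; rewrite ?[LHS]flatmx0 ?[RHS]flatmx0 //;
  exact: orthogonal1.
have [a ra] := symmetric_real_root sA.
have rb : root (char_poly B) a by rewrite -eAB.
have [P [A' [oP sA' PA]]] := @symmetric_deflation _ _ A a sA ra.
have [Q [B' [oQ sB' QB]]] := @symmetric_deflation _ _ B a sB rb.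
have eAB' : char_poly A' = char_poly B'.
  apply: (@mulfI _ ('X - a%:P)); first by rewrite polyXsubC_eq0.
  by rewrite -!char_poly_block1 -PA -QB !char_poly_orthogonal.
have [U [V [d [oU oV UA VB]]]] := IHn _ _ sA' sB' eAB'.
have glue (L L' : 'M[R]_n) (S W : 'M[R]_(1 + n)) :
    S *m W *m S^T = block_mx a%:M 0 0 L' -> L *m L' *m L^T = diag_mx d ->
    let T := block_mx 1%:M 0 0 L *m S in
    T *m W *m T^T = diag_mx (row_mx a%:M d).
  move=> SW LL /=; rewrite trmx_mul !mulmxA -(mulmxA (block_mx _ _ _ _) S).
  rewrite -(mulmxA (block_mx _ _ _ _) _ S^T) SW tr_block_mx !trmx0 trmx1.
  rewrite !mulmx_block !(mulmx0, mul0mx, mul1mx, mulmx1, addr0, add0r) LL.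
  rewrite diag_mx_row; congr block_mx; apply/matrixP => i j.
  by rewrite !mxE !ord1.
exists (block_mx 1%:M 0 0 U *m P), (block_mx 1%:M 0 0 V *m Q), (row_mx a%:M d).
split.
- by apply: orthogonal_mul => //; exact: orthogonal_block1.
- by apply: orthogonal_mul => //; exact: orthogonal_block1.
- exact: glue PA UA.
- exact: glue QB VB.
Qed.

(** * Isometries from equal moments *)

(** Test the vanishing moments against the polynomial whose roots are the
    values of [d] other than [c]. *)
Lemma moments_fiber_sum (R : idomainType) n (d z : 'I_n -> R) :
  (forall k, \sum_a d a ^+ k * z a = 0) ->
  forall c, \sum_(a | d a == c) z a = 0.
Proof.
move=> mom c.
have vanish (f : {poly R}) : \sum_a f.[d a] * z a = 0.
  transitivity (\sum_(k < size f) f`_k * \sum_a d a ^+ k * z a).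
    under eq_bigr do rewrite horner_coef mulr_suml.
    rewrite exchange_big; apply: eq_bigr => k _.
    by rewrite mulr_sumr; apply: eq_bigr => a _; rewrite mulrA.
  by apply: big1 => k _; rewrite mom mulr0.
pose f := \prod_(a | d a != c) ('X - (d a)%:P).
have fc : f.[c] != 0.
  rewrite horner_prod prodf_seq_neq0; apply/allP => a _; apply/implyP => dac.
  by rewrite !hornerE subr_eq0 eq_sym.
apply: (mulfI fc); rewrite mulr0 mulr_sumr -[RHS](vanish f).
rewrite [RHS](bigID (fun a => d a == c)) /= [X in _ = _ + X]big1 ?addr0.
  by apply: eq_bigr => a /eqP ->.
by move=> a dac; rewrite horner_prod (bigD1 a) //= !hornerE subrr !mul0r.
Qed.

(** The orthogonal projection of [x] onto the eigenspace of [diag_mx d] for the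
    eigenvalue [c]. *)
Definition fiber_part (R : pzRingType) n (d : 'rV[R]_n) c
    (x : 'cV[R]_n) : 'cV[R]_n :=
  \col_a (x a 0 *+ (d 0 a == c)).

Lemma fiber_part_eigen (R : comPzRingType) n (d : 'rV[R]_n) c x :
  diag_mx d *m fiber_part d c x = c *: fiber_part d c x.
Proof.
apply/matrixP => a j; rewrite mul_diag_mx !mxE.
by case: eqP => [->|_]; rewrite ?mulr0n ?mulr0.
Qed.

Lemma sum_fiber_part (R : pzRingType) n (d : 'rV[R]_n) x :
  x = \sum_(c <- undup [seq d 0 a | a <- enum 'I_n]) fiber_part d c x.
Proof.
apply/matrixP => a j; rewrite ord1 summxE (bigD1_seq (d 0 a)) ?undup_uniq //=.
  rewrite mxE eqxx mulr1n big1 ?addr0 // => c /negPf; rewrite mxE eq_sym => ->.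
  by rewrite mulr0n.
by rewrite mem_undup map_f // mem_enum.
Qed.

Lemma dot_fiber_part (R : comPzRingType) n (d : 'rV[R]_n) c c' x y :
  dot (fiber_part d c x) (fiber_part d c' y)
  = (\sum_(a | d 0 a == c) x a 0 * y a 0) *+ (c == c').
Proof.
rewrite /dot mxE -sumrMnl [RHS]big_mkcond; apply: eq_bigr => a _; rewrite !mxE.
case: (eqVneq (d 0 a) c) => [->|_]; last by rewrite mulr0n mul0r.
by case: (c == c'); rewrite ?mulr1n // !mulr0n mulr0.
Qed.

Lemma moments_diag (R : comNzRingType) n (U A : 'M[R]_n) d (e e' : 'cV[R]_n) k :
  orthogonal_mx U -> U *m A *m U^T = diag_mx d ->
  bil e (A ^+ k) e' = \sum_a d 0 a ^+ k * ((U *m e) a 0 * (U *m e') a 0).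
Proof.
move=> [UU _] UA.
have eUA : U *m A = diag_mx d *m U by rewrite -UA -mulmxA UU mulmx1.
have Ak (w : 'cV_n) a : (U *m (A ^+ k *m w)) a 0 = d 0 a ^+ k * (U *m w) a 0.
  elim: k w => [|k IHk] w; first by rewrite !expr0 mul1mx mul1r.
  rewrite exprSr -[A ^+ k * A]/(A ^+ k *m A) -mulmxA IHk.
  by rewrite mulmxA eUA -mulmxA mul_diag_mx mxE exprSr mulrA.
rewrite /bil -mulmxA -[LHS]/(dot e (A ^+ k *m e')).
rewrite -(dot_orthogonal _ _ UU) /dot mxE; apply: eq_bigr => a _.
by rewrite Ak mxE mulrCA.
Qed.

(** In coordinates where both matrices are the same diagonal matrix, the
    eigenspace components of the two families have equal Gram matrices, so an
    isometry commuting with the diagonal matrix matches them, and with them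
    their sums. *)
Lemma equal_moments_isometry (R : rcfType) n p (A B : 'M[R]_n)
    (e f : 'I_p -> 'cV[R]_n) :
  A^T = A -> B^T = B -> char_poly A = char_poly B ->
  (forall i j k, bil (e i) (A ^+ k) (e j) = bil (f i) (B ^+ k) (f j)) ->
  exists Q, [/\ orthogonal_mx Q, Q^T *m A *m Q = B
    & forall i, Q^T *m e i = f i].
Proof.
move=> sA sB eAB mom.
have [U [V [d [oU oV UA VB]]]] := cospectral_diagonalization sA sB eAB.
pose x i := U *m e i; pose y i := V *m f i.
have gram i j c : \sum_(a | d 0 a == c) x i a 0 * x j a 0
    = \sum_(a | d 0 a == c) y i a 0 * y j a 0.
  apply/eqP; rewrite -subr_eq0 -sumrB; apply/eqP.
  apply: moments_fiber_sum => k.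
  under eq_bigr do rewrite mulrBr.
  rewrite sumrB -(moments_diag _ _ _ oU UA) -(moments_diag _ _ _ oV VB).
  by rewrite mom subrr.
pose part a i :=
  (d 0 a, (fiber_part d (d 0 a) (x i), fiber_part d (d 0 a) (y i))).
(* A repeated eigenvalue lists the same pairs several times, harmlessly. *)
pose s := [seq part a i | a <- enum 'I_n, i <- enum 'I_p].
have [||u v|] := @eigenpairs_isometry _ _ (diag_mx d) s.
- exact: tr_diag_mx.
- by move=> _ /allpairsP[u [_ _ ->]]; rewrite !fiber_part_eigen.
- move=> /allpairsP[u' [_ _ ->]] /allpairsP[v' [_ _ ->]].
  by rewrite !dot_fiber_part gram.
move=> Q [oQ QD Qs].
have Qx i : Q *m x i = y i.
  rewrite [x i](sum_fiber_part d) [y i](sum_fiber_part d) mulmx_sumr.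
  apply: eq_big_seq => c; rewrite mem_undup => /mapP[a _ ->].
  by apply: (Qs (part a i)); apply/allpairsP; exists (a, i); rewrite !mem_enum.
exists (U^T *m Q^T *m V); split.
- apply: orthogonal_mul => //; apply: orthogonal_mul; exact: orthogonal_tr.
- have [UU _] := oU; have [VV _] := oV; have [_ QQ] := oQ.
  have -> : A = U^T *m diag_mx d *m U.
    by rewrite -UA !mulmxA UU mul1mx -mulmxA UU mulmx1.
  have -> : B = V^T *m diag_mx d *m V.
    by rewrite -VB !mulmxA VV mul1mx -mulmxA VV mulmx1.
  have [_ UU'] := oU.
  rewrite !trmx_mul !trmxK !mulmxA -(mulmxA _ U U^T) UU' mulmx1.
  rewrite -(mulmxA _ U U^T) UU' mulmx1 -(mulmxA _ Q) QD -!mulmxA.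
  by rewrite (mulmxA Q) QQ mul1mx.
- move=> i; have [VV _] := oV.
  by rewrite !trmx_mul !trmxK -!mulmxA -/(x i) Qx mulmxA VV mul1mx.
Qed.

(** * Walk counts of graphs *)

Lemma tr_adjmx (T : pzRingType) n (G : sgraph 'I_n) :
  (adjmx T G)^T = adjmx T G.
Proof. by apply/matrixP => u v; rewrite !mxE setUC. Qed.

Lemma map_adjmx (T T' : pzRingType) (f : {rmorphism T -> T'}) n
    (G : sgraph 'I_n) :
  map_mx f (adjmx T G) = adjmx T' G.
Proof. by apply/matrixP => u v; rewrite !mxE rmorph_nat. Qed.

Lemma map_charvec (T T' : pzRingType) (f : {rmorphism T -> T'}) n
    (S : {set 'I_n}) :
  map_mx f (charvec T S) = charvec T' S.
Proof. by apply/matrixP => u v; rewrite !mxE rmorph_nat. Qed.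

Lemma map_Jmx (T T' : pzRingType) (f : {rmorphism T -> T'}) n (S : {set 'I_n}) :
  map_mx f (Jmx T S) = Jmx T' S.
Proof. by rewrite /Jmx map_mxM -map_trmx map_charvec. Qed.

Lemma lincomb_adj_J (T : comPzRingType) n p (P : 'I_p -> {set 'I_n})
    (G : sgraph 'I_n) (s : (1 + p).-tuple T) :
  lincomb_mx (adj_J_tuple T P G) s
  = tnth s ord0 *: adjmx T G + \sum_(i < p) tnth s (lift ord0 i) *: Jmx T (P i).
Proof.
rewrite /lincomb_mx big_ord_recl tnth0; congr (_ + _).
by apply: eq_bigr => i _; rewrite tnthS tnth_mktuple.
Qed.

Lemma multi_charpoly_real (R : rcfType) n p (P : 'I_p -> {set 'I_n})
    (G : sgraph 'I_n) (z t : R) (c : 'I_p -> R) :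
  multi_charpoly (adj_J_tuple R[i] P G)
    [tuple of (real_complex R z) :: [tuple real_complex R (c i) | i < p]]
    (real_complex R t)
  = real_complex R
      (\det (t%:M - (z *: adjmx R G + \sum_(i < p) c i *: Jmx R (P i)))).
Proof.
rewrite /multi_charpoly lincomb_adj_J -det_map_mx; congr (\det _).
rewrite map_mxB map_scalar_mx map_mxD map_mxZ map_adjmx tnth0.
congr (_ - (_ + _)).
rewrite map_mx_sum; apply: eq_bigr => i _.
by rewrite tnthS tnth_mktuple map_mxZ map_Jmx.
Qed.

Lemma horner_char_poly (R : comNzRingType) n (A : 'M[R]_n) t :
  (char_poly A).[t] = \det (t%:M - A).
Proof.
rewrite -[LHS]/(horner_eval t _) -det_map_mx; congr (\det _).
apply/matrixP => i j; rewrite /char_poly_mx !mxE /= /horner_eval.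
by rewrite hornerD hornerN hornerC hornerMn hornerX.
Qed.

Lemma walk_count_ge0 (R : numDomainType) n (G : sgraph 'I_n)
    (S S' : {set 'I_n}) k :
  0 <= bil (charvec R S) (adjmx R G ^+ k) (charvec R S').
Proof.
have mulge0 m l q (M : 'M[R]_(m, l)) (N : 'M[R]_(l, q)) :
    (forall a b, 0 <= M a b) -> (forall a b, 0 <= N a b) ->
    forall a b, 0 <= (M *m N) a b.
  by move=> M0 N0 a b; rewrite mxE sumr_ge0 // => i _; rewrite mulr_ge0.
have vec0 W a b : 0 <= charvec R W a b by rewrite mxE ler0n.
rewrite /bil; apply: (mulge0) => //; apply: (mulge0).
  by move=> a b; rewrite mxE.
elim: k => [|k IHk] a b; first by rewrite expr0 mxE ler0n.
by rewrite exprS; apply: (mulge0) => // u v; rewrite mxE ler0n.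
Qed.

(** The weights [(l == i) + (l == j)] give the perturbation by [J_i + J_j]
    whether or not [i] and [j] are equal.  A sign -1 would make two nonnegative
    numbers opposite, hence both zero. *)
Lemma eq_charpoly_walk_counts (R : rcfType) n p (G H : sgraph 'I_n)
    (P : 'I_p -> {set 'I_n}) (A := adjmx R G) (B := adjmx R H) :
  (forall (z : R) (c : 'I_p -> R),
    \det (1%:M - (z *: A + \sum_(i < p) c i *: Jmx R (P i)))
    = \det (1%:M - (z *: B + \sum_(i < p) c i *: Jmx R (P i)))) ->
  forall i j k, bil (charvec R (P i)) (A ^+ k) (charvec R (P j))
    = bil (charvec R (P i)) (B ^+ k) (charvec R (P j)).
Proof.
move=> eD i j; pose u := charvec R (P i); pose v := charvec R (P j).
have symP z (G' : sgraph 'I_n) :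
    (1%:M - z *: adjmx R G')^T = 1%:M - z *: adjmx R G'.
  by rewrite linearB linearZ /= trmx1 tr_adjmx.
have single m : \sum_(l < p) (l == m)%:R *: Jmx R (P l) = Jmx R (P m).
  rewrite (bigD1 m) //= eqxx scale1r big1 ?addr0 // => l /negPf ->.
  by rewrite scale0r.
have eD0 z : \det (1%:M - z *: A) = \det (1%:M - z *: B).
  have := eD z (fun=> 0).
  by rewrite big1 ?addr0 // => l _; rewrite scale0r.
have eD1 z m : \det (1%:M - z *: A - Jmx R (P m))
    = \det (1%:M - z *: B - Jmx R (P m)).
  by have := eD z (fun l => (l == m)%:R); rewrite single !opprD !addrA.
have eD2 z : \det (1%:M - z *: A - (Jmx R (P i) + Jmx R (P j)))
    = \det (1%:M - z *: B - (Jmx R (P i) + Jmx R (P j))).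
  have := eD z (fun l => (l == i)%:R + (l == j)%:R).
  under eq_bigr do rewrite scalerDl.
  by rewrite big_split /= !single -!addrA -!opprD.
have [z nz|s s2 ekm] := @resolvent_moments R n A B u v eD0.
  apply: (resolvent_sqr (symP z G) (symP z H) (eD0 z) nz).
  - exact: eD1.
  - exact: eD1.
  - exact: eD2.
move=> k; rewrite -/u -/v.
move/eqP: s2; rewrite -[X in _ == X](expr1n _ 2) eqf_sqr => /orP[] /eqP s1.
  by rewrite ekm s1 mul1r.
have ek := ekm k; rewrite s1 mulN1r in ek.
have Bk0 : bil u (B ^+ k) v = 0.
  apply/eqP; rewrite eq_le walk_count_ge0 andbT -oppr_ge0 -ek.
  exact: walk_count_ge0.
by rewrite ek Bk0 oppr0.
Qed.

(** * Walk matrices, levels and invariant factors *)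

Lemma map_walk_mx (T T' : pzRingType) (f : {rmorphism T -> T'}) n p
    (P : 'I_p -> {set 'I_n}) (A : 'M[T]_n) :
  map_mx f (walk_mx P A) = walk_mx P (map_mx f A).
Proof.
have mapX k : map_mx f (A ^+ k) = map_mx f A ^+ k.
  elim: k => [|k IHk]; first by rewrite !expr0 map_mx1.
  by rewrite !exprS -IHk; exact: map_mxM.
apply/matrixP => i j; rewrite mxE [walk_mx _ _ i j]mxE [RHS]mxE mxE [RHS]mxE.
by rewrite -mapX -(map_charvec f) -map_mxM [RHS]mxE.
Qed.

Lemma intertwining_walk_mx (T : comNzRingType) n p (P : 'I_p -> {set 'I_n})
    (Q A B : 'M[T]_n) :
  orthogonal_mx Q -> Q^T *m A *m Q = B ->
  (forall i, Q^T *m charvec T (P i) = charvec T (P i)) ->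
  Q^T *m walk_mx P A = walk_mx P B.
Proof.
move=> [_ QQ] QA Qe; rewrite /walk_mx mul_mxrow; apply/eq_mxrow => i.
have QAB : Q^T *m A = B *m Q^T by rewrite -QA -mulmxA QQ mulmx1.
have Qk k : Q^T *m (A ^+ k *m charvec T (P i)) = B ^+ k *m charvec T (P i).
  elim: k => [|k IHk]; first by rewrite !expr0 !mul1mx.
  by rewrite !exprS -[in LHS]mulmxA mulmxA QAB -mulmxA IHk mulmxA.
apply/matrixP => v j; rewrite [RHS]mxE -Qk [LHS]mxE [RHS]mxE.
by apply: eq_bigr => w _; congr (_ * _); rewrite [LHS]mxE.
Qed.

(** The integers clearing the denominators of [M] form an ideal: the remainder
    of [x] modulo the level clears them too, so minimality forces it to be 0. *)
Lemma level_dvd m n (M : 'M[rat]_(m, n)) (x : int) :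
  integral_mx (x%:~R *: M) -> ((level M)%:Z %| x)%Z.
Proof.
move=> xM; rewrite /level; case: ex_minnP => l /andP[l_gt0 lM] l_min.
apply/dvdz_mod0P; apply/eqP.
have l_neq0 : l%:Z != 0 by rewrite eqz_nat -lt0n.
have r_ge0 := modz_ge0 x l_neq0.
have [r er] : exists r : nat, (x %% l)%Z = r.
  by exists `|(x %% l)%Z|%N; rewrite gez0_abs.
have r_lt : (r < l)%N by rewrite -ltz_nat -er ltz_pmod.
have rM : integral_mx (r%:R *: M).
  have -> : r%:R *: M = x%:~R *: M - (x %/ l)%Z%:~R *: (l%:R *: M).
    rewrite scalerA -scalerBl; congr (_ *: _).
    have := congr1 (intr : int -> rat) (divz_eq x l).
    by rewrite rmorphD rmorphM /= er !pmulrn => ->; rewrite addrC addKr.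
  apply/mxOverP => i j; rewrite mxE [X in _ + X]mxE.
  rewrite rpredB //; first exact: (mxOverP xM).
  by rewrite mxE rpredM ?rpred_int //; exact: (mxOverP lM).
rewrite er; have [->//|r_neq0] := eqVneq r 0%N.
by have := l_min r; rewrite lt0n r_neq0 rM leqNgt r_lt => /(_ isT).
Qed.

Lemma unimodular_unit n (U : 'M[int]_n) : unimodular U -> U \in unitmx.
Proof. by rewrite unitmxE => -[] ->. Qed.

(** In [W = U S V] the j-th column of [Q U] becomes integral after
    multiplication by the j-th diagonal entry of [S], hence after multiplication
    by the last one; [U] and [V] are invertible over the integers. *)
Lemma last_invariant_factor_clears (F : numFieldType) n m
    (W W' : 'M[int]_(n, m)) (Q : 'M[F]_n) (x : int) :
  (n <= m)%N -> last_invariant_factor W x ->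
  Q *m map_mx intr W = map_mx intr W' ->
  exists Z : 'M[int]_n, x%:~R *: Q = map_mx intr Z.
Proof.
move=> le_nm [U [d [V [[uniU uniV sd d_sorted eW] ->]]]] QW.
have uU := unimodular_unit uniU; have uV := unimodular_unit uniV.
rewrite (minn_idPl le_nm) in sd *; set x' := d`_n.-1.
pose Y := W' *m invmx V.
pose D : 'M[int]_(n, m) := \matrix_(i, j) (d`_i *+ (i == j :> nat)).
have DE a b : D a b = d`_a *+ (a == b :> nat) by rewrite mxE.
have QUD : Q *m map_mx intr U *m map_mx intr D = map_mx intr Y.
  rewrite map_mxM -QW eW 2!map_mxM !mulmxA -(mulmxA _ (map_mx intr V)) -map_mxM.
  by rewrite mulmxV // map_mx1 mulmx1.
have QUdj i (j : 'I_n) :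
    (Q *m map_mx intr U) i j * (d`_j)%:~R = (Y i (widen_ord le_nm j))%:~R.
  have /matrixP/(_ i (widen_ord le_nm j)) := QUD.
  rewrite [RHS]mxE => <-; rewrite [RHS]mxE (bigD1 j) //= big1 ?addr0 => [|l lj].
    by congr (_ * _); rewrite [RHS]mxE DE eqxx mulr1n.
  have lj_nat : (l == j :> nat) = false by exact: negbTE.
  by rewrite [X in _ * X]mxE DE /= lj_nat mulr0.
have dvdx (j : 'I_n) : (d`_j %| x')%Z.
  have n_gt0 : (0 < n)%N by exact: leq_trans (ltn_ord j).
  have lt_pred : (n.-1 < n)%N by rewrite prednK.
  have le_pred : (j <= n.-1)%N by rewrite -ltnS prednK.
  have dvdz_tr : transitive dvdz by move=> a b c; exact: dvdz_trans.
  have := sorted_leq_nth dvdz_tr dvdzz 0 d_sorted.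
  by move/(_ j n.-1); rewrite !inE sd => /(_ _ _ le_pred); exact.
pose T : 'M[int]_n := \matrix_(i, j) ((x' %/ d`_j)%Z * Y i (widen_ord le_nm j)).
have xQU : x'%:~R *: (Q *m map_mx intr U) = map_mx intr T.
  apply/matrixP => i j; rewrite mxE [RHS]mxE [T i j]mxE rmorphM /= -QUdj.
  rewrite -{1}(divzK (dvdx j)) rmorphM /= -mulrA.
  by congr (_ * _); exact: mulrC.
exists (T *m invmx U).
by rewrite map_mxM -xQU -scalemxAl -mulmxA -map_mxM mulmxV // map_mx1 mulmx1.
Qed.

(** If the last diagonal entry vanished, the last row of the inverse of [U]
    would annihilate [W]. *)
Lemma last_invariant_factor_neq0 (F : numFieldType) n m
    (W : 'M[int]_(n, m)) (x : int) :
  (0 < n)%N -> row_free (map_mx intr W : 'M[F]_(n, m)) ->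
  last_invariant_factor W x -> x != 0.
Proof.
move=> n_gt0 fW.
have le_nm : (n <= m)%N by rewrite -(eqP fW) rank_leq_col.
move=> [U [d [V [[/unimodular_unit uU _ _ _ eW] ->]]]].
rewrite (minn_idPl le_nm); apply/eqP => dn0.
have lt_n : (n.-1 < n)%N by rewrite prednK.
pose j := Ordinal lt_n; pose r := row j (invmx U).
have rW : r *m W = 0.
  rewrite eW -row_mul !mulmxA mulVmx // mul1mx row_mul.
  have -> : row j (\matrix_(i < n, j < m) (d`_i *+ (i == j :> nat))) = 0.
    by apply/matrixP => a b; rewrite !mxE dn0 mul0rn.
  by rewrite mul0mx.
have r0 : map_mx intr r = 0 :> 'M[F]_(1, n).
  by apply: (row_free_inj fW); rewrite mul0mx -map_mxM rW map_mx0.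
have rU : r *m U = delta_mx 0 j by rewrite -row_mul mulVmx // rowE mulmx1.
have /matrixP/(_ 0 j) := congr1 (map_mx (intr : int -> F)) rU.
by rewrite map_mxM r0 mul0mx !mxE !eqxx => /esym/eqP; rewrite oner_eq0.
Qed.

(** * Rationality, and the theorem *)

(** Some last invariant factor yields the rational matrix; every other one
    clears its denominators too, because [ratr] is injective. *)
Lemma intertwining_rational (R : archiRealFieldType) n m (W W' : 'M[int]_(n, m))
    (Q : 'M[R]_n) :
  row_free (map_mx intr W : 'M[R]_(n, m)) ->
  Q^T *m map_mx intr W = map_mx intr W' ->
  exists Qrat : 'M[rat]_n, Q = map_mx ratr Qrat /\
    forall x : int, last_invariant_factor W x -> ((level Qrat)%:Z %| x)%Z.
Proof.
move=> fW QW.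
have [n_eq0|n_gt0] := posnP n.
  move: n_eq0 W W' Q fW QW => -> W W' Q _ _; exists 0; split.
    by apply/matrixP => -[].
  (* The last invariant factor of an empty matrix is the default value 0. *)
  move=> x [U [d [V [[_ _ sd _ _] ->]]]].
  by rewrite nth_default ?dvdz0 // sd min0n.
have le_nm : (n <= m)%N by rewrite -(eqP fW) rank_leq_col.
have [x0 lif_x0] := last_invariant_factor_exists W.
have x0_neq0 := last_invariant_factor_neq0 n_gt0 fW lif_x0.
have [Z0 eZ0] := last_invariant_factor_clears le_nm lif_x0 QW.
pose Qrat : 'M[rat]_n := (x0%:~R)^-1 *: map_mx intr Z0^T.
have eQ : Q = map_mx ratr Qrat.
  rewrite map_mxZ fmorphV /= ratr_int -map_mx_comp.
  rewrite (eq_map_mx _ (@ratr_int R)) -[LHS]trmxK -map_trmx -eZ0.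
  rewrite linearZ /= scalerA.
  by rewrite mulVf ?intr_eq0 // scale1r.
exists Qrat; split=> // x lif_x.
have [Z eZ] := last_invariant_factor_clears le_nm lif_x QW.
apply: level_dvd; suff -> : x%:~R *: Qrat = map_mx intr Z^T.
  by apply/mxOverP => i j; rewrite mxE; exact: rpred_int.
apply: (@map_mx_inj _ _ (ratr : {rmorphism rat -> R})).
rewrite map_mxZ /= ratr_int -eQ -map_mx_comp (eq_map_mx _ (@ratr_int R)).
by rewrite -map_trmx -eZ linearZ /= trmxK.
Qed.

Theorem theorem1p3 (R : realType) (n p : nat) (G H : sgraph 'I_n)
    (P : 'I_p -> {set 'I_n}) (P_partition : vertex_partition P) :
  let A := adj_J_tuple R[i] P G in
  let B := adj_J_tuple R[i] P H in
  let A1 := adjmx R G in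
  let B1 := adjmx R H in
  let intertwines (Q : 'M[R]_n) :=
    [/\ orthogonal_mx Q, Q^T *m A1 *m Q = B1
      & forall i : 'I_p, Q^T *m charvec R (P i) = charvec R (P i)] in
  [/\ (forall (s : (1 + p).-tuple R[i]) (t : R[i]),
         multi_charpoly A s t = multi_charpoly B s t)
      <-> (exists Q : 'M[R]_n, intertwines Q),
      forall Q : 'M[R]_n, intertwines Q ->
        Q^T *m walk_mx P A1 = walk_mx P B1
    & row_free (walk_mx P A1) ->
      forall Q : 'M[R]_n, intertwines Q ->
        (forall Q' : 'M[R]_n, intertwines Q' -> Q' = Q) /\
        (exists Qrat : 'M[rat]_n,
           Q = map_mx ratr Qrat /\
           forall x : int,
             last_invariant_factor (walk_mx P (adjmx int G)) x ->
             ((level Qrat)%:Z %| x)%Z)].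
Proof.
move=> A B A1 B1 intertwines.
have walkQ Q : intertwines Q -> Q^T *m walk_mx P A1 = walk_mx P B1.
  by case=> oQ QA Qe; exact: intertwining_walk_mx.
split=> [|//|free_walk Q iQ]; first split.
- move=> eAB.
  have eD (t z : R) (c : 'I_p -> R) :
      \det (t%:M - (z *: A1 + \sum_(i < p) c i *: Jmx R (P i)))
      = \det (t%:M - (z *: B1 + \sum_(i < p) c i *: Jmx R (P i))).
    by apply: complexI; rewrite -!multi_charpoly_real; exact: eAB.
  apply: equal_moments_isometry; rewrite ?tr_adjmx //.
    apply: poly_ext => t; have := eD t 1 (fun=> 0).
    rewrite !horner_char_poly big1 => [|i _]; rewrite ?scale0r //.
    by rewrite !addr0 !scale1r.
  by apply: eq_charpoly_walk_counts => z c; exact: eD.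
- move=> [Q [[QQ' QQ] QA Qe]] s t; rewrite /multi_charpoly.
  pose q := map_mx (real_complex R) Q.
  have qq' : q^T *m q = 1%:M by rewrite map_trmx -map_mxM QQ' map_mx1.
  have qA : q^T *m adjmx R[i] G *m q = adjmx R[i] H.
    by rewrite -!(map_adjmx (real_complex R)) map_trmx -!map_mxM QA.
  have qe i : q^T *m charvec R[i] (P i) = charvec R[i] (P i).
    by rewrite -!(map_charvec (real_complex R)) map_trmx -map_mxM Qe.
  have qJ i : q^T *m Jmx R[i] (P i) *m q = Jmx R[i] (P i).
    have := congr1 trmx (qe i); rewrite trmx_mul trmxK => eq_e.
    by rewrite /Jmx mulmxA qe -mulmxA eq_e.
  have -> : t%:M - lincomb_mx B s = q^T *m (t%:M - lincomb_mx A s) *m q.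
    rewrite !lincomb_adj_J mulmxBr mulmxBl mul_mx_scalar -scalemxAl.
    rewrite qq' scalemx1.
    congr (_ - _); rewrite mulmxDr mulmxDl -scalemxAr -scalemxAl qA.
    congr (_ + _).
    rewrite mulmx_sumr mulmx_suml; apply: eq_bigr => i _.
    by rewrite -scalemxAr -scalemxAl qJ.
  by rewrite !det_mulmx mulrAC -det_mulmx qq' det1 mul1r.
split=> [Q' iQ'|].
  by apply/trmx_inj/(row_free_inj free_walk); rewrite !walkQ.
apply: (@intertwining_rational _ _ _ _ (walk_mx P (adjmx int H))).
  by rewrite map_walk_mx map_adjmx.
by rewrite !map_walk_mx !map_adjmx walkQ.
Qed.
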